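(* Let $f:\mathbb{R}\to\mathbb{C}$ be a Lebesgue measurable function which is not zero almost everywhere and which has faster than exponential decay, i.e. $\lim_{x\to\infty}|f(x)|e^{cx}=0$ for every $c>0$. Then for every $b>0$, $\mathcal G(f,\mathbb{R}\times b\mathbb{Z})$ is linearly independent.
   Context: For $a,t\in\mathbb{R}$, $M_aT_tf(x)=e^{2\pi i a x}f(x-t)$, and $\mathcal G(f,\mathbb{R}\times b\mathbb{Z})=\{M_aT_tf: a\in\mathbb{R},\ t\in b\mathbb{Z}\}$. Measurable functions equal a.e. are identified; this system is linearly independent if every finite linear combination of its elements over distinct pairs $(a,t)$ with coefficients not all zero is not zero almost everywhere. *)

(* Defs.v *)
From mathcomp Require Import all_boot all_algebra all_classical all_reals all_analysis.
From mathcomp Require Export complex.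
Set Implicit Arguments.
Unset Strict Implicit.
Unset Printing Implicit Defensive.
Import GRing.Theory Num.Theory.
Local Open Scope ring_scope.
Local Open Scope classical_set_scope.

(* The real line equipped with the Lebesgue (= completed, Caratheodory)
   sigma-algebra; its measure is completed_lebesgue_measure. *)
Definition LebR (R : realType) : measurableType _ :=
  caratheodory_type ((wlength (R:=R) idfun)^*%mu).

Definition lebesgue_measurable_C (R : realType) (f : R -> R[i]) : Prop :=
  measurable_fun [set: LebR R] ((fun z => @complex.Re R z) \o f : LebR R -> R) /\
  measurable_fun [set: LebR R] ((fun z => @complex.Im R z) \o f : LebR R -> R).

Definition cmod (R : realType) (z : R[i]) : R := Num.sqrt (complex.Re z ^+ 2 + complex.Im z ^+ 2).

Definition expi (R : realType) (theta : R) : R[i] := (cos theta +i* sin theta)%C.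

Definition MT (R : realType) (a t : R) (f : R -> R[i]) (x : R) : R[i] :=
  expi (2 * (pi : R) * a * x) * f (x - t).

Definition ae_zero (R : realType) (g : R -> R[i]) : Prop :=
  {ae (@completed_lebesgue_measure R), forall x : LebR R, g x = 0}.

(* Main.v *)
Require Import Defs.
From mathcomp Require Import all_boot all_order all_algebra all_classical all_reals all_analysis.
From mathcomp Require Import complex measurable_realfun ring lra.
Import Order.TTheory GRing.Theory Num.Theory.
Import numFieldNormedType.Exports.
Local Open Scope ring_scope.
Local Open Scope classical_set_scope.

(* In a vanishing combination, collect the terms with the largest time shift
   T = b k among those with nonzero coefficient: they form P(x) f(x - T) with P
   a nonzero trigonometric polynomial.  Along an orbit x + bN the relation reads
   |P(x + T + bn)| v_n <= W max_(j >= 1) v_(n+j), where v_n = |f(x + bn)|, so a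
   bound on the far tail of v propagates back to v_0 at the price of the
   factors W / |P(x + T + bn)|.  For almost every x the product of the first M
   of these factors is at most K^M for infinitely many M, which the
   superexponential decay of v beats; hence f(x) = 0.

   The bound on the products comes from a sublevel estimate
   mu {x in [-D, D] : |P(x + y)| < 2^-(mk)} <= C 2^-k, uniform in y, by Fatou's
   lemma applied to the averages over n < M of the functions
   sum_k 1{|P(. + y_n)| < 2^-(mk)}, which dominate log_2(1/|P|) / m.  The sublevel
   estimate is by induction on the number of frequencies: after modulating one
   frequency to 0, the derivative of P has one frequency less. *)

(** * Lebesgue outer measure and sublevel sets of functions with large derivative *)

Section outer.
Variable R : realType.
Notation mu := (@lebesgue_measure R).

(* [lebesgue_measure] is defined on all sets and is there the outer measure:
   monotonicity and subadditivity need no measurability. *)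
Definition leb_outer : {outer_measure set R -> \bar R} :=
  [the {outer_measure set (ocitv_type R) -> \bar R} of (wlength idfun)^*%mu].

Lemma leb_outerE (A : set R) : mu A = leb_outer A.
Proof. by []. Qed.

Lemma le_leb (A B : set R) : A `<=` B -> (mu A <= mu B)%E.
Proof. by rewrite !leb_outerE; exact: le_outer_measure. Qed.

(** The set lies in the ball of radius [r] around any of its points, whence the factor 2. *)
Lemma leb_small (A : set R) (r : R) : 0 <= r ->
  (forall x y, A x -> A y -> x < y -> y - x <= r) -> (mu A <= (r *+ 2)%:E)%E.
Proof.
move=> r0 hA; have [->|/set0P[x Ax]] := eqVneq A set0.
  by rewrite measure0 lee_fin mulrn_wge0.
apply: (@le_trans _ _ (mu `[x - r, x + r]%classic)).
  apply: le_leb => y Ay /=; rewrite in_itv/=.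
  case: (ltgtP x y) => [xy|yx|->].
  - by have := hA _ _ Ax Ay xy; lra.
  - by have := hA _ _ Ay Ax yx; lra.
  - by lra.
rewrite lebesgue_measure_itv/= lte_fin; case: ifPn => _; rewrite -?EFinD lee_fin; lra.
Qed.

Lemma leb_itv (D : R) : 0 < D -> mu `[- D, D]%classic = (D *+ 2)%:E.
Proof.
move=> D0; rewrite lebesgue_measure_itv/= lte_fin ifT; last by lra.
by rewrite -EFinD; congr (_%:E); lra.
Qed.

Lemma leb_U2 (A B : set R) : (mu (A `|` B) <= mu A + mu B)%E.
Proof. by rewrite !leb_outerE; exact: outer_measureU2. Qed.


Lemma is_derive_continuous (u u1 : R -> R) :
  (forall x : R, is_derive x (1 : R) u (u1 x)) -> continuous u.
Proof.
move=> du z; apply: differentiable_continuous; apply/derivable1_diffP.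
exact: ex_derive.
Qed.

(* On an interval of length d / (2K) meeting {d <= |u1|}, the derivative stays
   above d / 2 in absolute value, so {|u| < e} has diameter at most 4e/d there. *)
Lemma sublevel_transversal (K D : R) : 1 <= K -> 0 < D ->
  exists2 C : R, 0 <= C & forall (u u1 : R -> R) (e d : R),
    (forall x : R, is_derive x (1 : R) u (u1 x)) ->
    (forall x y, `|u1 x - u1 y| <= K * `|x - y|) ->
    0 < e -> 0 < d <= 1 ->
    (mu [set x : R | (- D <= x <= D)%R /\ (`|u x| < e)%R /\ (d <= `|u1 x|)%R] <=
      (C * (e / d ^+ 2))%:E)%E.
Proof.
move=> K1 D0; exists (8 * (4 * D * K + 1)); first by nra.
move=> u u1 e d du lipu e0 /andP[d0 d1].
set A := [set x | _].
pose h := d / (2 * K).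
have h0 : 0 < h by apply: divr_gt0; lra.
have hK : K * h = d / 2 by rewrite /h; field; lra.
pose N := (Num.truncn (2 * D / h)).+1.
have t0 : 0 <= 2 * D / h by apply: divr_ge0; lra.
have /andP[N1 N2] := truncn_itv t0; rewrite -/N in N2.
have NE : N%:R <= 4 * D * K / d + 1.
  rewrite /N -natr1 lerD2r (le_trans N1)//.
  by rewrite le_eqVlt; apply/orP; left; apply/eqP; rewrite /h; field; lra.
pose I (j : nat) := [set x | - D + j%:R * h <= x < - D + j.+1%:R * h].
have AI : A `<=` \big[setU/set0]_(j < N) (A `&` I j).
  move=> x Ax; have [/andP[x1 x2] _] := Ax.
  have x0 : 0 <= (x + D) / h by apply: divr_ge0; lra.
  have /andP[y1 y2] := truncn_itv x0.
  rewrite -(bigcup_mkord N (fun j => A `&` I j)); exists (Num.truncn ((x + D) / h)).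
    rewrite /= ltnS /N; apply: le_truncn.
    by rewrite ler_pM2r ?invr_gt0//; lra.
  split => //; rewrite /I /=.
  move: y1 y2; rewrite ler_pdivlMr// ltr_pdivrMr// => y1 y2; lra.
apply: (le_trans (le_leb _ _ AI)).
rewrite leb_outerE; apply: (le_trans (outer_measure_subadditive leb_outer (fun j => A `&` I j) N)).
apply: (@le_trans _ _ (\sum_(j < N) (4 * e / d *+ 2)%:E)%E).
  apply: lee_sum => j _; apply: leb_small; first by apply: divr_ge0; lra.
  move=> x y [[_ [ux dx]] /andP[Ix1 Ix2]] [[_ [uy _]] /andP[Iy1 Iy2]] xy.
  have [|c cxy E] := MVT xy (fun z _ => du z).
    by apply: continuous_subspaceT; exact: is_derive_continuous.
  move: cxy; rewrite in_itv/= => /andP[c1 c2].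
  have : `|u1 x - u1 c| <= d / 2.
    apply: (le_trans (lipu _ _)); rewrite -hK ler_pM2l//; last by lra.
    rewrite -natr1 in Ix2 Iy2.
    by rewrite ltr0_norm; lra.
  move=> h1.
  have h2 : d / 2 <= `|u1 c|.
    have := lerB_dist (u1 x) (u1 x - u1 c).
    by rewrite subKr => h3; lra.
  (* The mean value theorem gives (d/2)(y - x) <= |u y - u x| <= 2e, hence y - x <= 4e/d. *)
  have h3 : `|u y - u x| <= e + e by apply: (le_trans (ler_normB _ _)); lra.
  move: h3; rewrite E normrM (@gtr0_norm _ (y - x)); last by lra.
  move=> h3; rewrite ler_pdivlMr//; nra.
rewrite sumEFin lee_fin sumr_const card_ord -[X in X <= _]mulr_natl.
have e1 : 0 <= 4 * e / d *+ 2 by rewrite mulrn_wge0// divr_ge0//; lra.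
apply: (le_trans (ler_wpM2r e1 NE)).
have -> : (4 * D * K / d + 1) * (4 * e / d *+ 2) =
  8 * (4 * D * K + d) * (e / d ^+ 2) by field; lra.
apply: ler_wpM2r; last by nra.
by apply: divr_ge0; [lra | apply: exprn_ge0; lra].
Qed.

End outer.

(** * Null sets: translation, countable unions, and the completed measure *)

Section null.
Variable R : realType.
Notation mu := (@lebesgue_measure R).

(** A cover of [A] by half-open intervals, moved by -t, covers the translate with the same total
    length. *)
Lemma leb_shift (A : set R) (t : R) : (mu [set x : R | A (x + t)%R] <= mu A)%E.
Proof.
apply: le_ereal_inf => _ [F [mF AF] <-].
have shiftE k : exists ab : R * R, F k = `]ab.1, ab.2]%classic.
  by have [ab _ <-] := mF k; exists ab.
have {shiftE} [g gE] := choice shiftE.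
pose G k : set (ocitv_type R) := `](g k).1 - t, (g k).2 - t]%classic.
exists G; first split.
- by move=> k; exists ((g k).1 - t, (g k).2 - t).
- move=> x /= /AF[k _]; rewrite gE /= in_itv/= => xk.
  by exists k => //; rewrite /G /= in_itv/=; lra.
- apply: eq_eseriesr => k _; rewrite /G gE.
  have E (a b : R) : wlength idfun `]a, b]%classic =
      if (a < b)%R then (b - a)%:E else 0%E.
    by rewrite wlength_itv /= lte_fin; case: ifP.
  apply: (etrans (E _ _)); apply: (etrans _ (esym (E _ _))).
  by rewrite ltrD2r; case: ifP => // _; congr (_%:E); ring.
Qed.

Lemma leb_null_bigcup (F : nat -> set R) :
  (forall n, mu (F n) = 0%E) -> mu (\bigcup_n F n) = 0%E.
Proof.
move=> F0; apply/eqP; rewrite eq_le (outer_measure_ge0 (leb_outer R)) andbT.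
apply: (le_trans (outer_measure_sigma_subadditive (leb_outer R) F)).
by rewrite eseries0// => n _ _; exact: F0.
Qed.

Lemma leb_null_sub (A B : set R) : A `<=` B -> mu B = 0%E -> mu A = 0%E.
Proof.
move=> AB B0; apply/eqP; rewrite eq_le; apply/andP; split.
  by rewrite -B0; exact: le_leb.
exact: (outer_measure_ge0 (leb_outer R)).
Qed.

(** A set of outer measure zero is Caratheodory measurable, so almost everywhere statements for the
    completed measure reduce to the outer measure. *)
Lemma ae_zeroP (g : R -> R[i]) : ae_zero g <-> mu [set x | g x <> 0] = 0%E.
Proof.
split=> [[A [mA A0 gA]]|g0]; first exact: leb_null_sub gA A0.
exists [set x | g x <> 0]; split => //.
rewrite /measurable /=.
apply: le_caratheodory_measurable => X.
rewrite -[leRHS]add0e; apply: leeD; last by apply: le_outer_measure => x [].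
by rewrite -[leRHS]g0; apply: le_outer_measure => x [].
Qed.

End null.

(** * Almost everywhere bounds from integrated averages *)

Section averages.
Context {d : measure_display} {T : measurableType d} {R : realType}.
Variable mu : {measure set T -> \bar R}.
Local Open Scope ereal_scope.

(** By Fatou, the liminf of [H] has integral at most [c], so it is finite almost everywhere. *)
Lemma ae_liminf_bounded (D : set T) (H : nat -> T -> \bar R) (c : R) :
  measurable D -> (forall n, measurable_fun D (H n)) ->
  (forall n x, 0 <= H n x) -> (forall n, \int[mu]_(x in D) H n x <= c%:E) ->
  {ae mu, forall x, D x ->
    exists K : nat, forall N, exists2 M, (N <= M)%N & H M x <= K%:R%:E}.
Proof.
move=> mD mH H0 intH.
pose L x := limn_einf (H ^~ x).
have einfsH x n : einfs (H ^~ x) n <= L x.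
  rewrite /L limn_einf_lim (cvg_lim _ (@cvg_einfs_sup _ (H ^~ x)))//.
  by apply: ereal_sup_ubound; exists n.
have L0 x : 0 <= L x.
  apply: le_trans (einfsH x 0%N); apply: le_ereal_inf_tmp => _ [n _ <-].
  exact: H0.
have mL : measurable_fun D L.
  apply: (emeasurable_fun_cvg (fun n x => einfs (H ^~ x) n)).
    exact: measurable_fun_einfs.
  move=> x Dx; rewrite /L limn_einf_lim.
  exact: is_cvg_einfs.
have intL : \int[mu]_(x in D) L x <= c%:E.
  apply: le_trans (fatou mu mD mH (fun n x _ => H0 n x)) _.
  rewrite limn_einf_lim; apply: lime_le; first exact: is_cvg_einfs.
  apply: nearW => n; apply: le_trans (intH n).
  by apply: ereal_inf_lbound; exists n => /=.
have iL : mu.-integrable D L.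
  apply/integrableP; split => //.
  under eq_integral do rewrite gee0_abs//.
  by rewrite (le_lt_trans intL)// ltry.
move: (integrable_ae mD iL); apply: filterS => x fL Dx.
have {}fL := fL Dx.
(* This integer is strictly above the liminf; if it were exceeded by every [H n x] with n >= N, the
   infimum of that tail would exceed the liminf. *)
exists (Num.truncn (fine (L x))).+1 => N; apply: contrapT => noM.
have : (Num.truncn (fine (L x))).+1%:R%:E <= L x.
  apply: le_trans (einfsH x N); apply: le_ereal_inf_tmp => _ [n /= Nn <-].
  by rewrite leNgt; apply/negP => /ltW HK; apply: noM; exists n.
rewrite -(fineK fL) lee_fin leNgt => /negP; apply.
by have /andP[] := truncn_itv (fine_ge0 (L0 x)).
Qed.

(** [G n x] counts the k with w n x < 2^-(mk), so a finite count g gives w n x >= 2^-(mg). The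
    integrals of [G n], hence of its averages [H n], are at most 2c; where the average is at most K,
    the exponents in the product add up to at most mKM. *)
Lemma ae_product_ge (D : set T) (w : nat -> T -> R) (m : nat) (c : R) :
  measurable D -> (forall n, measurable_fun setT (w n)) ->
  (0 <= c)%R -> (forall n x, 0 <= w n x)%R ->
  (forall n k, mu ([set x | w n x < 2^-1 ^+ (m * k)]%R `&` D) <=
               (c * 2^-1 ^+ k)%:E) ->
  {ae mu, forall x, D x ->
    exists K : nat, forall N, exists2 M, (N <= M)%N &
      (2^-1 ^+ (m * (K * M)) <= \prod_(n < M) w n x)%R}.
Proof.
move=> mD mw c0 w0 hw.
pose E n k := [set x | w n x < 2^-1 ^+ (m * k)]%R.
have mE n k : measurable (E n k).
  have -> : E n k = setT `&` w n @^-1` `]-oo, (2^-1 ^+ (m * k))%R[%classic.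
    by rewrite setTI; apply/seteqP; split => x; rewrite /E /= in_itv.
  by apply: mw => //; exact: measurable_itv.
pose G n x : \bar R := \sum_(k <oo) (\1_(E n k) x)%:E.
have I0 n k x : 0 <= (\1_(E n k) x)%:E :> \bar R by rewrite lee_fin.
have mI n k : measurable_fun D (fun x => (\1_(E n k) x)%:E : \bar R).
  by apply/measurable_EFinP; exact: measurable_indic.
have G0 n x : 0 <= G n x by apply: nneseries_ge0 => k _ _; exact: I0.
have mG n : measurable_fun D (G n).
  by apply: ge0_emeasurable_sum => // k x _ _; exact: I0.
have intG n : \int[mu]_(x in D) G n x <= (2 * c)%:E.
  rewrite integral_nneseries//.
  (* The series of c 2^-k is written with terms 2c / 2^(k+1). *)
  apply: le_trans (epsilon_trick0 xpredT _); last by rewrite mulr_ge0.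
  apply: lee_nneseries => [k _ _|k _]; first exact: integral_ge0.
  rewrite integral_indic//; apply: le_trans (hw n k) _.
  rewrite lee_fin natrX exprS exprVn le_eqVlt; apply/orP; left; apply/eqP.
  by field; rewrite expf_neq0.
pose H n x : \bar R := (n.+1%:R^-1)%:E * \sum_(j < n.+1) G j x.
have S0 n x : 0 <= \sum_(j < n.+1) G j x by apply: sume_ge0 => j _.
have H0 n x : 0 <= H n x by apply: mule_ge0 => //; rewrite lee_fin.
have mS n : measurable_fun D (fun x => \sum_(j < n.+1) G j x).
  by apply: emeasurable_sum => j.
have mH n : measurable_fun D (H n) by apply: measurable_funeM.
have intH n : \int[mu]_(x in D) H n x <= (2 * c)%:E.
  rewrite ge0_integralZl//.
  rewrite ge0_integral_sum//.
  apply: (@le_trans _ _ ((n.+1%:R^-1)%:E * \sum_(j < n.+1) (2 * c)%:E)).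
    apply: lee_wpmul2l; first by rewrite lee_fin.
    by apply: lee_sum => j _.
  rewrite sumEFin -EFinM lee_fin sumr_const card_ord mulrnAr -mulrnAl.
  by rewrite -[X in (X * _)%R]mulr_natr mulVf ?pnatr_eq0// mul1r.
move: (ae_liminf_bounded D H (2 * c) mD mH H0 intH); apply: filterS => x /[apply].
move=> [K HK].
have Sle N : exists2 M, (N <= M)%N & \sum_(j < M.+1) G j x <= (K * M.+1)%:R%:E.
  have [M NM HM] := HK N; exists M => //.
  move: HM; rewrite /H muleC lee_pdivrMr// => /le_trans; apply.
  by rewrite -EFinM natrM.
have Gfin n : G n x < +oo.
  have [M nM le] := Sle n; apply: (@le_lt_trans _ _ (\sum_(j < M.+1) G j x)).
    rewrite (bigD1 (Ordinal (n:=M.+1) (m:=n) nM))//= leeDl//.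
    by apply: sume_ge0 => j _.
  exact: le_lt_trans le (ltry _).
(* Take the least k with w n x >= 2^-(mk): every smaller index contributes 1 to [G n x]. Such a k
   exists, since otherwise [G n x] would be infinite. *)
have wg n : exists g : nat, g%:R%:E <= G n x /\ (2^-1 ^+ (m * g) <= w n x)%R.
  have exk : exists k, (2^-1 ^+ (m * k) <= w n x)%R.
    apply: contrapT => /forallNP nok.
    have GK k : k%:R%:E <= G n x.
      rewrite /G; apply: le_trans (nneseries_lim_ge k _); last by move=> *; exact: I0.
      rewrite (eq_bigr (fun=> 1%:E)); last first.
        move=> j _; rewrite indicE mem_set//= /E /=.
        by rewrite ltNge; apply/negP/nok.
      by rewrite sumEFin big_const_nat iter_addr subn0 addr0.
    have := GK (Num.truncn (fine (G n x))).+1.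
    have fG : G n x \is a fin_num by rewrite ge0_fin_numE.
    rewrite -(fineK fG) lee_fin leNgt.
    by have /andP[_ ->] := truncn_itv (fine_ge0 (G0 n x)).
  have [g Pg gmin] := ex_minnP exk; exists g; split => //.
  rewrite /G; apply: le_trans (nneseries_lim_ge g _); last by move=> *; exact: I0.
  rewrite (eq_big_nat _ _ (F2 := fun=> 1%:E)); last first.
    move=> j /andP[_ jg]; rewrite indicE mem_set//= /E /=.
    rewrite ltNge; apply/negP => /gmin; by rewrite leqNgt jg.
  by rewrite sumEFin big_const_nat iter_addr subn0 addr0.
have [g gP] := choice wg.
exists K => N; have [M NM le] := Sle N; exists M.+1; first exact: leqW.
apply: (@le_trans _ _ (\prod_(n < M.+1) 2^-1 ^+ (m * g n))%R); last first.
  apply: ler_prod => n _; rewrite exprn_ge0 ?invr_ge0//=.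
  by have [] := gP n.
rewrite -expr_sum -big_distrr /=; apply: ler_wiXn2l; rewrite ?invr_ge0 ?invf_le1 ?ler1n//.
rewrite leq_mul2l; apply/orP; right.
rewrite -(ler_nat R) -lee_fin; apply: le_trans le.
rewrite natr_sum -sumEFin; apply: lee_sum => j _.
by have [] := gP j.
Qed.

End averages.

(** * Trigonometric polynomials and their sublevel sets *)

Section trig.
Variable R : realType.
Notation mu := (@lebesgue_measure R).
Implicit Types (s : seq (R * R[i])).

Lemma cmodE (z : R[i]) : cmod z = ComplexField.Normc.normc z.
Proof. by case: z. Qed.

Lemma cmodM (z1 z2 : R[i]) : cmod (z1 * z2) = cmod z1 * cmod z2.
Proof. by rewrite !cmodE ComplexField.Normc.normcM. Qed.

Lemma cmodD (z1 z2 : R[i]) : cmod (z1 + z2) <= cmod z1 + cmod z2.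
Proof. by rewrite !cmodE le_normcD. Qed.

Lemma cmod_ge0 (z : R[i]) : 0 <= cmod z. Proof. exact: sqrtr_ge0. Qed.

Lemma cmod0 : cmod (0 : R[i]) = 0.
Proof. by rewrite cmodE ComplexField.Normc.normc0. Qed.

Lemma cmod_eq0 (z : R[i]) : (cmod z == 0) = (z == 0).
Proof.
rewrite cmodE; apply/eqP/eqP => [|->]; first exact: ComplexField.Normc.eq0_normc.
exact: ComplexField.Normc.normc0.
Qed.

Lemma Re_le_cmod (z : R[i]) : `|complex.Re z| <= cmod z.
Proof. by rewrite -sqrtr_sqr /cmod ler_wsqrtr// lerDl sqr_ge0. Qed.

Lemma Im_le_cmod (z : R[i]) : `|complex.Im z| <= cmod z.
Proof. by rewrite -sqrtr_sqr /cmod ler_wsqrtr// lerDr sqr_ge0. Qed.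

Lemma cmod_le_ReIm (z : R[i]) : cmod z <= `|complex.Re z| + `|complex.Im z|.
Proof.
rewrite -[leRHS]ger0_norm ?addr_ge0// -[leRHS]sqrtr_sqr /cmod ler_wsqrtr//.
rewrite sqrrD !real_normK ?num_real// lerD2r lerDl.
by rewrite mulrn_wge0// mulr_ge0.
Qed.

Lemma expiD (a b : R) : expi (a + b) = expi a * expi b.
Proof. by rewrite /expi cosD sinD; apply/eqP; rewrite eq_complex /= eqxx addrC eqxx. Qed.

Lemma cmod_expi (a : R) : cmod (expi a) = 1.
Proof. by rewrite /cmod /= cos2Dsin2 sqrtr1. Qed.

(** The frequencies are angular: the factor 2 pi of [MT] is absorbed into them, so differentiation
    multiplies a coefficient by i times its frequency. *)
Definition trig s (x : R) : R[i] := \sum_(p <- s) p.2 * expi (p.1 * x).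

Definition dtrig s : seq (R * R[i]) := [seq (p.1, (0 +i* p.1)%C * p.2) | p <- s].

Definition modulate (l : R) s : seq (R * R[i]) := [seq (p.1 - l, p.2) | p <- s].

Lemma trig_cons p s x : trig (p :: s) x = p.2 * expi (p.1 * x) + trig s x.
Proof. by rewrite /trig big_cons. Qed.

Lemma trig_modulate l s x : trig (modulate l s) x = expi (- l * x) * trig s x.
Proof.
rewrite /trig big_map big_distrr /=; apply: eq_bigr => p _.
by rewrite mulrBl expiD mulNr; ring.
Qed.

Lemma cmod_trig_le s x : cmod (trig s x) <= \sum_(p <- s) cmod p.2.
Proof.
elim: s => [|p s IHs]; first by rewrite /trig !big_nil cmod0.
rewrite trig_cons big_cons (le_trans (cmodD _ _))// lerD//.
by rewrite cmodM cmod_expi mulr1.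
Qed.

(** Real and imaginary parts are kept apart because the mean value theorem is for real-valued
    functions. *)
Lemma is_derive_trig s (y x : R) :
  is_derive x (1 : R) (fun x => complex.Re (trig s (x + y)))
    (complex.Re (trig (dtrig s) (x + y))) /\
  is_derive x (1 : R) (fun x => complex.Im (trig s (x + y)))
    (complex.Im (trig (dtrig s) (x + y))).
Proof.
elim: s => [|[l [c e]] s [IH1 IH2]].
  rewrite /trig big_nil; split.
    under eq_fun do rewrite big_nil; exact: is_derive_cst.
  under eq_fun do rewrite big_nil; exact: is_derive_cst.
have dl : is_derive x (1 : R) (fun x : R => l * (x + y)) l.
  have -> : (fun x : R => l * (x + y)) = l *: (id + cst y) :> (R -> R) by apply/funext.
  by apply: is_derive_eq; rewrite addr0 /GRing.scale /= mulr1.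
have dc := @is_derive1_comp _ cos (fun x : R => l * (x + y)) x _ _ (is_derive_cos _) dl.
have ds := @is_derive1_comp _ sin (fun x : R => l * (x + y)) x _ _ (is_derive_sin _) dl.
split.
- have -> : (fun x => complex.Re (trig ((l, (c +i* e)%C) :: s) (x + y))) =
    (c *: (cos \o (fun x => l * (x + y))) - e *: (sin \o (fun x => l * (x + y)))
     + (fun x => complex.Re (trig s (x + y)))) :> (R -> R).
    by apply/funext => z; rewrite trig_cons raddfD.
  apply: is_derive_eq.
  rewrite /dtrig /= -/(dtrig s) trig_cons raddfD/=; congr (_ + _).
  by rewrite /GRing.scale/=; ring.
- have -> : (fun x => complex.Im (trig ((l, (c +i* e)%C) :: s) (x + y))) =
    (c *: (sin \o (fun x => l * (x + y))) + e *: (cos \o (fun x => l * (x + y)))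
     + (fun x => complex.Im (trig s (x + y)))) :> (R -> R).
    by apply/funext => z; rewrite trig_cons raddfD.
  apply: is_derive_eq.
  rewrite /dtrig /= -/(dtrig s) trig_cons raddfD/=; congr (_ + _).
  by rewrite /GRing.scale/=; ring.
Qed.

Lemma lipschitz_of_derive (u u1 : R -> R) (K : R) :
  (forall x : R, is_derive x (1 : R) u (u1 x)) -> (forall x, `|u1 x| <= K) ->
  forall x y, `|u x - u y| <= K * `|x - y|.
Proof.
move=> du hK; suff H x y : x < y -> `|u x - u y| <= K * `|x - y|.
  move=> x y; case: (ltgtP x y) => [/H//|/H|->]; last by rewrite !subrr normr0 mulr0.
  by rewrite distrC (distrC y).
move=> xy; have [|c _ E] := MVT xy (fun x _ => du x).
  by apply: continuous_subspaceT; exact: is_derive_continuous.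
by rewrite distrC E normrM (distrC x) ler_wpM2r.
Qed.

(** The derivative is bounded by the sum of the moduli of its coefficients, whatever the point,
    whence uniformity in [y]. The added 1 meets the condition [1 <= K] of [sublevel_transversal]. *)
Lemma trig_lipschitz s : exists2 K : R, 1 <= K & forall y x x',
  `|complex.Re (trig s (x + y)) - complex.Re (trig s (x' + y))| <= K * `|x - x'| /\
  `|complex.Im (trig s (x + y)) - complex.Im (trig s (x' + y))| <= K * `|x - x'|.
Proof.
exists (1 + \sum_(p <- dtrig s) cmod p.2).
  by rewrite lerDl sumr_ge0// => p _; exact: cmod_ge0.
have bnd z : cmod (trig (dtrig s) z) <= 1 + \sum_(p <- dtrig s) cmod p.2.
  by rewrite (le_trans (cmod_trig_le _ _))// lerDr.
move=> y x x'; split.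
- apply: (@lipschitz_of_derive (fun x => complex.Re (trig s (x + y))) _ _
    (fun z => (is_derive_trig s y z).1)) => z.
  exact: le_trans (Re_le_cmod _) (bnd _).
- apply: (@lipschitz_of_derive (fun x => complex.Im (trig s (x + y))) _ _
    (fun z => (is_derive_trig s y z).2)) => z.
  exact: le_trans (Im_le_cmod _) (bnd _).
Qed.

(** Where the modulated polynomial is small, either its derivative is below [dd], which the
    induction hypothesis covers, or the real or imaginary part of the derivative is at least dd/2
    and [sublevel_transversal] applies. Each added frequency triples the exponent. *)
Lemma trig_sublevel (D : R) s : 0 < D -> s != [::] -> uniq (map fst s) ->
  {in s, forall p, p.2 != 0} ->
  exists (m : nat) (C : R), 0 <= C /\ forall y k,
    (mu [set x : R | (- D <= x <= D)%R /\
          (cmod (trig s (x + y)) < 2^-1 ^+ (m.+1 * k))%R] <=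
      (C * 2^-1 ^+ k)%:E)%E.
Proof.
move=> D0; have [n] := ubnP (size s); elim: n s => // n IHn [//|p [|q s]] sn _ us s0.
  have p0 : 0 < cmod p.2 by rewrite lt_def cmod_ge0 cmod_eq0 s0 ?mem_head.
  (* With one frequency the modulus is the constant |p.2|: the sublevel set is empty, or |p.2| <
     2^-k and the full length 2D is below (2D / |p.2|) 2^-k. *)
  exists 0%N, (D *+ 2 / cmod p.2); split.
    by rewrite divr_ge0 ?cmod_ge0// mulrn_wge0// ltW.
  move=> y k; rewrite mul1n.
  have cE x : cmod (trig [:: p] (x + y)) = cmod p.2.
    by rewrite /trig big_seq1 cmodM cmod_expi mulr1.
  have [pk|pk] := ltP (cmod p.2) (2^-1 ^+ k).
    apply: (@le_trans _ _ (mu `[- D, D]%classic)).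
      by apply: le_leb => x [+ _]; rewrite /= in_itv.
    rewrite leb_itv// lee_fin mulrAC ler_pdivlMr//.
    by rewrite ler_wpM2l ?ltW// mulrn_wgt0.
  apply: (@le_trans _ _ (mu set0)).
    by apply: le_leb => x [_] /=; rewrite cE ltNge pk.
  rewrite measure0 lee_fin mulr_ge0 ?exprn_ge0 ?invr_ge0//.
  by rewrite divr_ge0 ?cmod_ge0// mulrn_wge0// ltW.
set l := p.1; set g := modulate l (p :: q :: s).
pose t := dtrig (modulate l (q :: s)).
(* Modulation makes [p] constant, so that differentiation drops it. *)
have dg z : trig (dtrig g) z = trig t z.
  rewrite /g /t trig_cons /= -/l subrr -[Complex 0 0]/(0 : R[i]).
  by rewrite !mul0r add0r.
have [||||m [C [C0 HC]]] := IHn t.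
- by rewrite /t /dtrig /modulate !size_map.
- by [].
- rewrite /t /dtrig /modulate -!map_comp (map_comp (fun x => x - l) fst).
  rewrite map_inj_uniq; last exact: addIr.
  by case/andP: us.
(* The frequencies being distinct, none of the others is moved to 0, so differentiation drops no
   further term. *)
- move=> r /mapP[r' /mapP[r'' rs ->] ->] /=; rewrite mulf_neq0//; last first.
    by apply: s0; rewrite inE rs orbT.
  rewrite eq_complex /= eqxx /= subr_eq0; apply: contraTneq us => rl.
  by rewrite [map _ _]/= cons_uniq -/l -rl (map_f fst rs).
have [K K1 HK] := trig_lipschitz t.
have [C' C'0 HC'] := sublevel_transversal R K D K1 D0.
(* Tripling the exponent makes e = dd^3, so that e / (dd/2)^2 = 4 dd <= 4 2^-k; the real and
   imaginary parts contribute 4C' each. *)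
exists (m.+1 * 3).-1, (C + 8 * C'); split; first by rewrite addr_ge0// mulr_ge0.
move=> y k; rewrite prednK ?muln_gt0//.
set e := 2^-1 ^+ _; set dd := 2^-1 ^+ (m.+1 * k) : R.
have dd0 : 0 < dd by rewrite exprn_gt0// invr_gt0.
have dd1 : dd <= 1 by rewrite exprn_ile1// ?invr_ge0// invf_le1// ler1n.
have eE : e = dd ^+ 3 by rewrite /e /dd -exprM mulnAC.
have e0 : 0 < e by rewrite eE exprn_gt0.
pose B1 := [set x : R | (- D <= x <= D)%R /\
   (cmod (trig t (x + y)) < dd)%R].
pose B2 := [set x : R | (- D <= x <= D)%R /\
   (`|complex.Re (trig g (x + y))| < e)%R /\
   (dd / 2 <= `|complex.Re (trig t (x + y))|)%R].
pose B3 := [set x : R | (- D <= x <= D)%R /\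
   (`|complex.Im (trig g (x + y))| < e)%R /\
   (dd / 2 <= `|complex.Im (trig t (x + y))|)%R].
have sub : [set x : R | (- D <= x <= D)%R /\
   (cmod (trig (p :: q :: s) (x + y)) < e)%R] `<=` B1 `|` (B2 `|` B3).
  move=> x [xD xe].
  have ge : cmod (trig g (x + y)) < e by rewrite trig_modulate cmodM cmod_expi mul1r.
  have [h1|h1] := ltP (cmod (trig t (x + y))) dd; first by left.
  right; have := le_trans h1 (cmod_le_ReIm _).
  have [h2 _|h2 h3] := leP (dd / 2) `|complex.Re (trig t (x + y))|.
    by left; split=> //; split=> //; apply: le_lt_trans ge; exact: Re_le_cmod.
  right; split=> //; split; first by apply: le_lt_trans ge; exact: Im_le_cmod.
  by lra.
apply: (le_trans (le_leb _ _ _ sub)).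
apply: (le_trans (leb_U2 _ _ _)).
rewrite mulrDl EFinD; apply: leeD; first exact: HC.
apply: (le_trans (leb_U2 _ _ _)).
have ddk : C' * (e / (dd / 2) ^+ 2) <= 4 * C' * 2^-1 ^+ k.
  have -> : C' * (e / (dd / 2) ^+ 2) = 4 * C' * dd by rewrite eE; field; lra.
  rewrite ler_wpM2l ?mulr_ge0//; apply: ler_wiXn2l; rewrite ?invr_ge0// ?invf_le1 ?ler1n//.
  exact: leq_pmull.
apply: (@le_trans _ _ (C' * (e / (dd / 2) ^+ 2) + C' * (e / (dd / 2) ^+ 2))%:E); last first.
  by rewrite lee_fin; lra.
have dd2 : 0 < dd / 2 <= 1 by lra.
rewrite EFinD; apply: leeD.
- apply: (HC' (fun x => complex.Re (trig g (x + y)))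
    (fun x => complex.Re (trig t (x + y))) e (dd / 2)) => //.
  + by move=> x; have := (is_derive_trig g y x).1; rewrite dg.
  + by move=> x x'; have [] := HK y x x'.
- apply: (HC' (fun x => complex.Im (trig g (x + y)))
    (fun x => complex.Im (trig t (x + y))) e (dd / 2)) => //.
  + by move=> x; have := (is_derive_trig g y x).2; rewrite dg.
  + by move=> x x'; have [] := HK y x x'.
Qed.

End trig.

(** * Backward recurrence along an orbit, and its product condition *)

Section recurrence.
Variable R : realType.
Notation mu := (@lebesgue_measure R).

(* The hypothesis on [v] and [a] is the relation [a n * v n <= sup_(j > n) v j]
   scaled by [c], stated without suprema. *)
Lemma backward_recurrence_eq0 (v a : nat -> R) (rho : R) :
  (forall n, 0 <= v n) -> (forall n, 0 <= a n <= 1) ->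
  (forall n c B, 0 <= c -> 0 <= B -> (forall j, (n < j)%N -> c * v j <= B) ->
    c * a n * v n <= B) ->
  (forall r, 0 < r < 1 -> exists M0, forall n, (M0 <= n)%N -> v n <= r ^+ n) ->
  0 < rho <= 1 ->
  (forall N, exists2 M, (N <= M)%N & rho ^+ M <= \prod_(n < M) a n) ->
  v 0%N = 0.
Proof.
move=> v0 a01 rec decay /andP[rho0 rho1] prodge.
(* By induction on [M], with [a M] absorbed into the scale [c]: the recurrence extends the tail
   bound to index [M], and [a M <= 1] keeps it beyond. *)
have back M c B : 0 <= c -> 0 <= B -> (forall m, (M <= m)%N -> c * v m <= B) ->
    forall m, c * \prod_(n < M) a n * v m <= B.
  elim: M c => [|M IHM] c c0 B0 hM m; first by rewrite big_ord0 mulr1 hM.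
  have /andP[aM0 aM1] := a01 M.
  rewrite big_ord_recr/= [_ * a M]mulrC mulrA.
  apply: IHM => //; first exact: mulr_ge0.
  move=> j; rewrite leq_eqVlt => /predU1P[<-|Mj]; first by apply: rec => // i; exact: hM.
  apply: le_trans (hM _ Mj); rewrite ler_wpM2r//.
  by rewrite ler_piMr.
(* Decay at rate rho/2 against products at least rho^M leaves v 0 <= 2^-M. *)
have r01 : 0 < rho / 2 < 1 by lra.
have [M0 HM0] := decay _ r01.
apply/eqP; rewrite eq_le v0 andbT leNgt; apply/negP => v0gt.
(* With N > 1 / v 0, any M >= N has 2^M > M > 1 / v 0, a contradiction. *)
pose N := (maxn M0 (Num.truncn (v 0%N)^-1).+1).
have [M NM le] := prodge N.
have : \prod_(n < M) a n * v 0%N <= (rho / 2) ^+ M.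
  rewrite -[X in X * _]mul1r; apply: back => //.
    by rewrite exprn_ge0//; lra.
  move=> m Mm; rewrite mul1r; apply: le_trans (HM0 m _) _.
    by rewrite (leq_trans _ Mm)// (leq_trans _ NM)// leq_maxl.
  by apply: ler_wiXn2l => //; lra.
move=> le2; have : rho ^+ M * v 0%N <= (rho / 2) ^+ M.
  by apply: le_trans le2; rewrite ler_wpM2r.
rewrite expr_div_n ler_pM2l ?exprn_gt0// => le3.
have : 1 < (2 ^+ M) * v 0%N.
  have vV : 0 < (v 0%N)^-1 by rewrite invr_gt0.
  rewrite -ltr_pdivrMr// mul1r; apply: (@lt_trans _ _ N%:R).
    apply: (@lt_le_trans _ _ (Num.truncn (v 0%N)^-1).+1%:R).
      by have /andP[] := truncn_itv (ltW vV).
    by rewrite ler_nat leq_maxr.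
  by rewrite -natrX ltr_nat (leq_ltn_trans NM)// ltn_expl.
by rewrite ltNge -ler_pdivlMl ?exprn_gt0// mulr1 le3.
Qed.

Lemma superexp_decay_seq (f : R -> R[i]) (b x : R) : 0 < b ->
  (forall c : R, 0 < c -> (cmod (f x) * expR (c * x)) @[x --> +oo] --> 0) ->
  forall r, 0 < r < 1 -> exists M0, forall n, (M0 <= n)%N ->
    cmod (f (x + b * n%:R)) <= r ^+ n.
Proof.
move=> b0 decay r /andP[r0 r1].
(* This rate makes e^(-cbn) = r^n; the tolerance e^(cx) below cancels the contribution of the
   starting point [x]. *)
pose c := - ln r / b.
have c0 : 0 < c by rewrite divr_gt0// oppr_gt0 ln_lt0// r0.
have e0 : 0 < expR (c * x) := expR_gt0 _.
have /cvgrPdist_le /(_ _ e0) [X [_ HX]] := decay c c0.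
exists (Num.truncn (Num.max 0 ((X - x) / b))).+1 => n Mn.
have Xn : X < x + b * n%:R.
  rewrite -ltrBlDl mulrC -ltr_pdivrMr//.
  apply: (@lt_le_trans _ _ (Num.truncn (Num.max 0 ((X - x) / b))).+1%:R); last by rewrite ler_nat.
  apply: (@le_lt_trans _ _ (Num.max 0 ((X - x) / b))); first by rewrite le_max lexx orbT.
  by have /andP[] := @truncn_itv _ (Num.max 0 ((X - x) / b)) (ltac:(by rewrite le_max lexx)).
have := HX _ Xn.
rewrite sub0r normrN ger0_norm ?mulr_ge0 ?cmod_ge0 ?expR_ge0//.
rewrite mulrDr expRD mulrCA ger_pMr//.
have -> : c * (b * n%:R) = - (n%:R * ln r) by rewrite /c; field; lra.
rewrite expRN mulrC expRM_natl lnK ?posrE//.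
by rewrite -ler_pdivlMl ?invr_gt0 ?exprn_gt0// invrK mulr1.
Qed.

Lemma exists_max_seq (A : eqType) (F : A -> R) (s : seq A) : s != [::] ->
  exists2 p, p \in s & forall q, q \in s -> F q <= F p.
Proof.
elim: s => // a [_ _|b s /(_ isT)[p ps pmax] _].
  by exists a; rewrite ?mem_head// => q; rewrite inE => /eqP ->.
have [ap|pa] := leP (F a) (F p).
  exists p; first by rewrite inE ps orbT.
  by move=> q; rewrite inE => /predU1P[->//|/pmax].
exists a; first exact: mem_head.
by move=> q; rewrite inE => /predU1P[->//|/pmax/le_trans]; apply; exact: ltW.
Qed.

Lemma measurable_cmod_trig (s : seq (R * R[i])) (y : R) :
  measurable_fun setT (fun x : R => cmod (trig R s (x + y))).
Proof.
apply: (measurableT_comp (continuous_measurable_fun (@sqrt_continuous R))).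
apply: measurable_funD; apply: measurable_funX.
- apply: continuous_measurable_fun; apply: is_derive_continuous => x.
  exact: (is_derive_trig R s y x).1.
- apply: continuous_measurable_fun; apply: is_derive_continuous => x.
  exact: (is_derive_trig R s y x).2.
Qed.

(** The sublevel estimate is uniform in the shift, so [y] may be any sequence. Truncating at 1
    leaves the sublevel sets at levels at most 1 unchanged, and the line is exhausted by bounded
    intervals. *)
Lemma trig_product_ge (s : seq (R * R[i])) (y : nat -> R) :
  s != [::] -> uniq (map fst s) -> {in s, forall p, p.2 != 0} ->
  mu [set x | ~ exists2 rho, 0 < rho <= 1 & forall N, exists2 M, (N <= M)%N &
    rho ^+ M <= \prod_(n < M) Num.min 1 (cmod (trig R s (x + y n)))] = 0%E.
Proof.
move=> sn us s0; set Bad := [set x | _].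
apply: (@leb_null_sub R _ (\bigcup_A (Bad `&` `[- A.+1%:R, A.+1%:R]%classic))).
  move=> x xB; exists (Num.truncn `|x|) => //; split => //=.
  have /andP[_ /ltW] := truncn_itv (normr_ge0 x).
  by rewrite ler_norml in_itv.
apply: leb_null_bigcup => A.
have [m [C [C0 HC]]] := trig_sublevel R A.+1%:R s (ltr0Sn _ _) sn us s0.
pose w n (x : R) := Num.min 1 (cmod (trig R s (x + y n))).
have [] := @ae_product_ge _ _ R mu `[- A.+1%:R, A.+1%:R]%classic w m.+1 C.
- exact: measurable_itv.
- by move=> n; apply: measurable_minr => //; exact: measurable_cmod_trig.
- by [].
- by move=> n x; rewrite /w le_min ler01 cmod_ge0.
- move=> n k; apply: le_trans (HC (y n) k); apply: le_leb => x [/= h].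
  rewrite in_itv/= => xA; split => //.
  move: h; rewrite /w gt_min => /orP[|//].
  by rewrite ltNge exprn_ile1// ?invr_ge0// invf_le1// ler1n.
move=> Z [mZ Z0 subZ]; apply: (leb_null_sub _ _ _ _ Z0) => x [xB xA].
apply: subZ => /= /(_ xA)[K HK]; apply: xB.
exists (2^-1 ^+ (m.+1 * K)).
  by rewrite exprn_gt0 ?invr_gt0//= exprn_ile1// ?invr_ge0// invf_le1// ler1n.
move=> N; have [M NM le] := HK N; exists M => //.
by rewrite -exprM -mulnA.
Qed.

End recurrence.

(** * From a vanishing combination to the backward recurrence *)

Theorem theorem3p3 (R : realType) (f : R -> R[i]) :
  lebesgue_measurable_C f ->
  ~ ae_zero f ->
  (forall c : R, 0 < c -> (cmod (f x) * expR (c * x)) @[x --> +oo] --> 0) ->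
  forall b : R, 0 < b ->
  (* linear independence of G(f, R x bZ) *)
  forall (s : seq (R * R)) (coef : R * R -> R[i]),
    uniq s ->
    (forall p, p \in s -> exists k : int, p.2 = b * k%:~R) ->
    has (fun p => coef p != 0) s ->
    ~ ae_zero (fun x => \sum_(p <- s) coef p * MT p.1 p.2 f x).
Proof.
move=> _ fn0 decay b b0 s coef us sb hc; set F := fun x => _.
move=> /ae_zeroP F0; apply: fn0; apply/ae_zeroP.
have [|p0] := @exists_max_seq R _ snd [seq p <- s | coef p != 0].
  by rewrite -size_eq0 size_filter -lt0n -has_count.
set T := p0.2; rewrite mem_filter => /andP[cp0 p0s] maxT.
pose Q p := (coef p != 0) && (p.2 == T).
pose tp := [seq (2 * pi * p.1, coef p) | p <- s & Q p].
have tpn : tp != [::].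
  rewrite -size_eq0 size_map size_filter -lt0n -has_count.
  by apply/hasP; exists p0; rewrite // /Q cp0 eqxx.
(* With the shift fixed at [T], distinct pairs have distinct modulations. *)
have tpu : uniq (map fst tp).
  rewrite -map_comp map_inj_in_uniq ?filter_uniq// => p q.
  rewrite !mem_filter => /andP[/andP[_ /eqP pT] _] /andP[/andP[_ /eqP qT] _] /=.
  have pi20 : 2 * pi != 0 :> R by rewrite mulf_neq0// gt_eqF// pi_gt0.
  move=> /(mulfI pi20); case: p q pT qT => [p1 p2] [q1 q2] /= -> ->.
  by move=> ->.
have tp0 : {in tp, forall p, p.2 != 0}.
  by move=> _ /mapP[p +] -> /=; rewrite mem_filter => /andP[/andP[]].
pose y n := T + b * n%:R.
pose W := 1 + \sum_(p <- s) cmod (coef p).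
have W1 : 1 <= W by rewrite lerDl sumr_ge0// => p _; exact: cmod_ge0.
have W0 : 0 < W by lra.
have Bad0 := trig_product_ge R tp y tpn tpu tp0.
set Bad := [set x | _] in Bad0.
(* Outside these countably many null sets the product bound holds and the relation [F = 0] holds at
   every point of the orbit. *)
pose Z n := if n is n'.+1 then [set x | F (x + y n') <> 0] else Bad.
apply: (@leb_null_sub R _ (\bigcup_n Z n)); last first.
  apply: leb_null_bigcup => -[//|n /=].
  apply/eqP; rewrite eq_le; apply/andP; split.
    by rewrite -F0; exact: (leb_shift R [set x | F x <> 0] (y n)).
  exact: (outer_measure_ge0 (leb_outer R)).
move=> x; apply: contraPP => nZ /=; rewrite not_notE.
have Fx n : F (x + y n) = 0.
  by apply: contrapT => Fn; apply: nZ; exists n.+1.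
have {nZ} [rho /andP[rho0 rho1] prodge] : exists2 rho, 0 < rho <= 1 & forall N,
    exists2 M, (N <= M)%N &
    rho ^+ M <= \prod_(n < M) Num.min 1 (cmod (trig R tp (x + y n))).
  by apply: contrapT => h; apply: nZ; exists 0%N.
(* The terms in [Q] factor as the polynomial times f(z); the others go to the right by the triangle
   inequality. The value of [F] is kept, as it vanishes only almost everywhere. *)
have cle z : cmod (trig R tp (z + T)) * cmod (f z) <=
    \sum_(p <- s | ~~ Q p) cmod (coef p) * cmod (f (z + (T - p.2))) +
    cmod (F (z + T)).
  have -> : cmod (trig R tp (z + T)) * cmod (f z) =
    cmod (\sum_(p <- s | Q p) coef p * MT p.1 p.2 f (z + T)).
    rewrite -cmodM /trig big_map big_filter big_distrl /=; congr cmod.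
    apply: eq_bigr => p /andP[_ /eqP pT].
    by rewrite /MT pT addrK mulrA.
  have -> : \sum_(p <- s | Q p) coef p * MT p.1 p.2 f (z + T) =
     - \sum_(p <- s | ~~ Q p) coef p * MT p.1 p.2 f (z + T) + F (z + T).
    by rewrite /F [X in _ = _ + X](bigID Q) /= [RHS]addrC -addrA subrr addr0.
  apply: le_trans (cmodD _ _ _) _; rewrite lerD2r cmodE normcN -cmodE.
  elim/big_rec2: _ => [|p B1 B2 _ le]; first by rewrite cmod0.
  apply: le_trans (cmodD _ _ _) _; rewrite lerD// /MT !cmodM cmod_expi mul1r.
  by rewrite addrA.
suff v0 : cmod (f (x + b * 0%:R)) = 0.
  by move/eqP: v0; rewrite cmod_eq0 mulr0 addr0 => /eqP.
(* Division by [W] turns the weighted sum of later values into a bound by their supremum; the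
   resulting W^M in the products is absorbed by taking rho/W. *)
apply: (@backward_recurrence_eq0 R (fun n => cmod (f (x + b * n%:R)))
  (fun n => Num.min 1 (cmod (trig R tp (x + y n))) / W) (rho / W)).
- by move=> n; exact: cmod_ge0.
- move=> n; rewrite divr_ge0 ?le_min ?ler01 ?cmod_ge0 ?(ltW W0)//=.
  by rewrite ler_pdivrMr// mul1r ge_min W1.
- move=> n c B c0 B0 hB /=.
  rewrite mulrAC mulrA ler_pdivrMr//.
  have h := cle (x + b * n%:R).
  rewrite -addrA (addrC _ T) -/(y n) Fx cmod0 addr0 in h.
  apply: (@le_trans _ _ (c * (cmod (trig R tp (x + y n)) * cmod (f (x + b * n%:R))))).
    rewrite mulrAC -mulrA ler_wpM2l// ler_wpM2r ?cmod_ge0//.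
    by rewrite ge_min lexx orbT.
  apply: (le_trans (ler_wpM2l c0 h)).
  apply: (@le_trans _ _ (\sum_(p <- s | ~~ Q p) cmod (coef p) * B)).
    rewrite big_distrr /= big_seq_cond [leRHS]big_seq_cond.
    apply: ler_sum => p /andP[ps nQ].
    rewrite mulrCA; have [cp|cp] := eqVneq (coef p) 0; first by rewrite cp cmod0 !mul0r.
    rewrite ler_wpM2l ?cmod_ge0//.
    (* A remaining term with nonzero coefficient has a strictly smaller shift; both shifts being in
       bZ, T - p.2 is bj with j >= 1, so the term sits at a later point of the same orbit. *)
    have pT : p.2 < T.
      rewrite lt_neqAle maxT ?mem_filter ?cp ?ps// andbT.
      by move: nQ; rewrite /Q cp.
    have [k0 E0] := sb _ p0s; have [k Ek] := sb _ ps.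
    have kk0 : (k < k0)%R.
      by move: pT; rewrite /T E0 Ek ltr_pM2l// ltr_int.
    have [j [Ej j0]] : exists j : nat, (k0 - k = j%:Z)%R /\ (0 < j)%N.
      have : 0 < k0 - k by rewrite subr_gt0.
      by case: (k0 - k) => // j j0; exists j.
    have -> : x + b * n%:R + (T - p.2) = x + b * (n + j)%:R.
      rewrite -addrA natrD mulrDr; congr (_ + (_ + _)).
      by rewrite /T E0 Ek -mulrBr -intrB Ej.
    by apply: hB; rewrite -[X in (X < _)%N]addn0 ltn_add2l.
  rewrite -big_distrl /= mulrC ler_wpM2l//.
  rewrite /W [X in _ <= _ + X](bigID Q) /=; have : 0 <= \sum_(p <- s | Q p) cmod (coef p).
    by apply: sumr_ge0 => p _; exact: cmod_ge0.
  by lra.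
- by move=> r r01; exact: superexp_decay_seq.
- by rewrite divr_gt0//= ler_pdivrMr// mul1r (le_trans rho1).
- move=> N; have [M NM le] := prodge N; exists M => //.
  rewrite big_split /= prodr_const card_ord expr_div_n exprVn.
  by rewrite ler_wpM2r// invr_ge0 exprn_ge0// ltW.
Qed.
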